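(* Let $\Delta>0$ be an integer that is not a perfect square. There is a one-to-one correspondence between the orbits under $\mathcal T$ of the good points of $H_\Delta$ and the cycles in $H^0$: every orbit contains exactly one cycle lying in $H^0$, and every cycle in $H^0$ belongs to exactly one orbit.
   Context: A form $f=mx^2+ny^2+kxy$ with integer coefficients is identified with the triple $\mathbf f=(m,n,k)\in\mathbb Z^3$, called a good point; its discriminant is $\Delta=k^2-4mn$. Put $K=k$, $D=m-n$, $S=m+n$, so $\Delta=K^2+D^2-S^2$, and $H_\Delta=\{K^2+D^2-S^2=\Delta\}$. $H^0$ is the part of $H_\Delta$ where $|S|<|D|$, $D>0$ (equivalently $m>0$, $n<0$). For $L\in\mathrm{SL}(2,\mathbb Z)$, $T_L$ sends $f$ to $f'$ with $f'(v)=f(Lv)$; $\mathcal T=\{T_L: L\in \mathrm{SL}(2,\mathbb Z)\}$. The orbit of $\mathbf f$ is $\{T\mathbf f: T\in\mathcal T\}$. $A(m,n,k)=(m,m+n+k,k+2m)$ and $B(m,n,k)=(m+n+k,n,k+2n)$. A cycle of length $t>1$ is a sequence of points $[\mathbf f_1,\dots,\mathbf f_t]$ such that $\mathbf f_i=T_{i-1}\mathbf f_{i-1}$ for $i=2,\dots,t$ and $\mathbf f_1=T_t\mathbf f_t$, where each $T_i$ is either $A$ or $B$; it is traversed once (the $\mathbf f_i$ are distinct), and sequences differing by a cyclic shift are the same cycle. A cycle is in $H^0$ if all its points are good points of $H^0$. *)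

(* Defs.v *)
From HB Require Import structures.
From mathcomp Require Import all_boot all_order all_algebra.
From mathcomp Require Import ring.
From mathcomp Require Import boolp classical_sets functions.

Set Implicit Arguments.
Unset Strict Implicit.
Unset Printing Implicit Defensive.

Import Order.TTheory GRing.Theory Num.Theory.
Local Open Scope classical_set_scope.
Local Open Scope ring_scope.

(* The triple (m, n, k) encodes the form m x^2 + n y^2 + k x y. *)
Definition good_point : Type := (int * int * int)%type.

Definition form_eval (f : good_point) (v : 'cV[int]_2) : int :=
  let: (m, n, k) := f in
  let x := v 0 0 in let y := v 1 0 in
  m * x ^+ 2 + n * y ^+ 2 + k * x * y.

Definition coordK (f : good_point) : int := let: (m, n, k) := f in k.
Definition coordD (f : good_point) : int := let: (m, n, k) := f in m - n.
Definition coordS (f : good_point) : int := let: (m, n, k) := f in m + n.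

Definition disc (f : good_point) : int :=
  let: (m, n, k) := f in k ^+ 2 - 4 * m * n.

Definition hyperboloid (Delta : int) : set good_point :=
  [set f | coordK f ^+ 2 + coordD f ^+ 2 - coordS f ^+ 2 = Delta].

Definition hyperboloid0 (Delta : int) : set good_point :=
  [set f | [/\ hyperboloid Delta f, `|coordS f| < `|coordD f| & 0 < coordD f]].

(* [transform L f], i.e. T_L f, is the form v |-> f (L v); its coefficients of
   x^2, y^2 and x y are recovered from its values at e_1, e_2 and e_1 + e_2
   (see [form_eval_transform]). *)
Definition transform (L : 'M[int]_2) (f : good_point) : good_point :=
  let g v := form_eval f (L *m v) in
  let e (i : 'I_2) : 'cV[int]_2 := delta_mx i 0 in
  (g (e 0), g (e 1), g (e 0 + e 1) - g (e 0) - g (e 1)).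

Definition orbit (f : good_point) : set good_point :=
  [set g | exists2 L : 'M[int]_2, \det L = 1 & g = transform L f].

Definition orbits (Delta : int) : set (set good_point) :=
  [set O | exists2 f, hyperboloid Delta f & O = orbit f].

Definition A (f : good_point) : good_point :=
  let: (m, n, k) := f in (m, m + n + k, k + 2 * m).

Definition B (f : good_point) : good_point :=
  let: (m, n, k) := f in (m + n + k, n, k + 2 * n).

Definition stepAB : rel good_point := fun f g => (g == A f) || (g == B f).

Definition cycle_seq (c : seq good_point) : Prop :=
  [/\ (1 < size c)%N, path.cycle stepAB c & uniq c].

(* A cycle is a class of sequences modulo cyclic shift. *)
Definition cycles : set (set (seq good_point)) :=
  [set C | exists2 c, cycle_seq c & C = [set c' | exists i, c' = rot i c]].

Definition cycle_points (C : set (seq good_point)) : set good_point :=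
  [set f | exists2 c, C c & f \in c].

Definition cycles_in (X : set good_point) : set (set (seq good_point)) :=
  [set C | cycles C /\ cycle_points C `<=` X].

Lemma discE f : disc f = coordK f ^+ 2 + coordD f ^+ 2 - coordS f ^+ 2.
Proof. by case: f => [[m n] k] /=; ring. Qed.

Lemma form_eval_transform L f v : form_eval (transform L f) v = form_eval f (L *m v).
Proof.
case: f => [[m n] k]; rewrite /transform /form_eval !mxE.
rewrite !big_ord_recl !big_ord0 !mxE.
have -> : ord0 = 0 :> 'I_2 by [].
have -> : lift 0 0 = 1 :> 'I_2 by apply: val_inj.
have [-> -> -> ->] : [/\ (0 == 0 :> 'I_2) = true, (0 == 1 :> 'I_2) = false,
    (1 == 0 :> 'I_2) = false & (1 == 1 :> 'I_2) = true] by [].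
rewrite eqxx /=.
move: (L 0 0) (L 0 1) (L 1 0) (L 1 1) (v 0 0) (v 1 0) => a b c d x y.
rewrite !(mulr0, mulr1, addr0, add0r).
ring.
Qed.

Lemma form_eval_inj f g : form_eval f =1 form_eval g -> f = g.
Proof.
case: f g => [[m n] k] [[m' n'] k'] E.
have e x y := E (\col_(i < 2) (if i == 0 then x else y)).
have {E}e x y : m * x ^+ 2 + n * y ^+ 2 + k * x * y =
                m' * x ^+ 2 + n' * y ^+ 2 + k' * x * y.
  by have := e x y; rewrite /form_eval !mxE.
have Em : m = m'.
  by have := e 1 0; rewrite expr1n expr0n /= !mulr1 !mulr0 !addr0.
have En : n = n'.
  by have := e 0 1; rewrite expr1n expr0n /= !mulr1 !mulr0 !add0r !addr0.
by have := e 1 1; rewrite Em En expr1n !mulr1 => /addrI ->.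
Qed.

(* Main.v *)
Require Import Defs.
From mathcomp Require Import all_boot all_order all_algebra.
From mathcomp Require Import zify ring.
From mathcomp Require Import boolp classical_sets functions.

(** The points of H^0 are the forms (m, n, k) with m > 0 > n.  Since the
    discriminant is not a square, no form represents 0 nontrivially, so for
    such a point f the value f(1, 1) = m + n + k is not 0: if it is positive
    only [B f] stays in H^0, if it is negative only [A f] does.  Hence [A] and
    [B] together induce a single map [river_step] on H^0 (one step along the
    river of Conway's topograph).  This map is injective, and H^0 is finite
    because k^2 + 4 m |n| = Delta, so [river_step] permutes H^0 and a cycle in
    H^0 is exactly a cycle of this permutation.

    What has to be shown is then that an orbit of SL(2, Z) meets H^0
    ([orbit_meets_river]) and that two points of H^0 in one orbit are joined by
    iterating [river_step] ([river_connected]).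

    The first is reduction: while m n > 0 one has k^2 > 4 m n, and adding or
    subtracting twice the smaller outer coefficient makes |k| smaller.

    For the second, let g = T_L f with f and g in H^0.  If L has nonnegative
    entries it is a product of the matrices of [A] and [B].  Following these
    factors from f, the path either stays in H^0, where it can only be
    [river_step], or leaves H^0; the form then has three coefficients of one
    sign, a property that [A] and [B] preserve, so it never returns ([climb]).
    If L^-1 has nonnegative entries, exchange f and g.  Up to the sign of L the
    only other case is that both columns of L, up to sign, lie in a common
    closed quadrant but in the wrong order.  Exchanging the columns and
    adjusting signs, after a reflection of the plane if necessary, gives a
    nonnegative matrix of determinant 1 that takes a point of H^0 to a form
    with m < 0 < n, which [climb] excludes. *)

Set Implicit Arguments.
Unset Strict Implicit.
Unset Printing Implicit Defensive.

Import Order.TTheory GRing.Theory Num.Theory.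
Local Open Scope classical_set_scope.
Local Open Scope ring_scope.

(* The name is also that of the orbit of a function on a finite type. *)
Local Notation orbit := Defs.orbit.

(** * The action of SL(2, Z) in coordinates *)

(** The coefficients of f(a x + b y, c x + d y).  Working with the four entries
    instead of the matrix turns all identities between transformed forms into
    polynomial identities over the integers. *)
Definition substitute (a b c d : int) (f : good_point) : good_point :=
  let: (m, n, k) := f in
  (m * a ^+ 2 + n * c ^+ 2 + k * a * c,
   m * b ^+ 2 + n * d ^+ 2 + k * b * d,
   2 * m * a * b + 2 * n * c * d + k * (a * d + b * c)).

Lemma det_mx2 (L : 'M[int]_2) : \det L = L 0 0 * L 1 1 - L 0 1 * L 1 0.
Proof.
rewrite (expand_det_row _ 0) !big_ord_recl big_ord0 /cofactor !det_mx11 !mxE.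
have -> : lift 0 0 = 1 :> 'I_2 by apply: val_inj.
have -> : lift 1 0 = 0 :> 'I_2 by apply: val_inj.
by rewrite /= expr0 expr1; ring.
Qed.

Lemma transformE L f :
  transform L f = substitute (L 0 0) (L 0 1) (L 1 0) (L 1 1) f.
Proof.
apply: form_eval_inj => v; rewrite form_eval_transform.
case: f => [[m n] k].
rewrite /form_eval /substitute !mxE !big_ord_recl !big_ord0.
have -> : ord0 = 0 :> 'I_2 by [].
have -> : lift 0 0 = 1 :> 'I_2 by apply: val_inj.
move: (L 0 0) (L 0 1) (L 1 0) (L 1 1) (v 0 0) (v 1 0) => a b c d x y.
ring.
Qed.

Lemma orbitP f g :
  orbit f g <-> exists a b c d, a * d - b * c = 1 /\ g = substitute a b c d f.
Proof.
split=> [[L detL ->] | [a [b [c [d [det1 ->]]]]]].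
  by exists (L 0 0), (L 0 1), (L 1 0), (L 1 1); rewrite transformE -det_mx2.
pose L : 'M[int]_2 := \matrix_(i, j)
  if i == 0 then if j == 0 then a else b else if j == 0 then c else d.
by exists L; rewrite ?det_mx2 ?transformE !mxE /=.
Qed.

Lemma substitute_comp a b c d a' b' c' d' f :
  substitute a' b' c' d' (substitute a b c d f) =
  substitute (a * a' + b * c') (a * b' + b * d')
             (c * a' + d * c') (c * b' + d * d') f.
Proof.
by case: f => [[m n] k]; rewrite /substitute; congr (_, _, _); ring.
Qed.

Lemma substitute1 f : substitute 1 0 0 1 f = f.
Proof. by case: f => [[m n] k]; rewrite /substitute; congr (_, _, _); ring. Qed.

Lemma orbit_refl f : orbit f f.
Proof. by apply/orbitP; exists 1, 0, 0, 1; rewrite substitute1. Qed.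

Lemma substituteK a b c d f : a * d - b * c = 1 ->
  substitute d (- b) (- c) a (substitute a b c d f) = f.
Proof.
move=> det1; rewrite substitute_comp -[RHS]substitute1.
by congr substitute; lia.
Qed.

Lemma orbit_sym f g : orbit f g -> orbit g f.
Proof.
move=> /orbitP[a [b [c [d [det1 ->]]]]]; apply/orbitP.
by exists d, (- b), (- c), a; rewrite substituteK //; split=> //; lia.
Qed.

Lemma orbit_trans f g h : orbit f g -> orbit g h -> orbit f h.
Proof.
move=> /orbitP[a [b [c [d [det1 ->]]]]] /orbitP[a' [b' [c' [d' [det1' ->]]]]].
apply/orbitP; rewrite substitute_comp; do 4 eexists; split; last by [].
rewrite -[1]mulr1 -{1}det1 -det1'; ring.
Qed.

Lemma orbit_eq f g : orbit f g -> orbit f = orbit g.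
Proof.
move=> fg; apply/seteqP; split=> h; last exact: orbit_trans.
by apply: orbit_trans; exact: orbit_sym.
Qed.

Lemma disc_substitute a b c d f : a * d - b * c = 1 ->
  disc (substitute a b c d f) = disc f.
Proof.
move=> det1; rewrite -[RHS]mul1r -(expr1n _ 2) -det1.
by case: f => [[m n] k] /=; ring.
Qed.

Lemma disc_orbit f g : orbit f g -> disc g = disc f.
Proof. by move=> /orbitP[a [b [c [d [det1 ->]]]]]; exact: disc_substitute. Qed.

Lemma orbit_A f : orbit f (A f).
Proof.
apply/orbitP; exists 1, 1, 0, 1; split=> //.
by case: f => [[m n] k]; rewrite /A /substitute; congr (_, _, _); ring.
Qed.

Lemma orbit_B f : orbit f (B f).
Proof.
apply/orbitP; exists 1, 0, 1, 1; split=> //.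
by case: f => [[m n] k]; rewrite /B /substitute; congr (_, _, _); ring.
Qed.

(** * The step map on H^0 *)

Definition indefinite (f : good_point) : bool :=
  let: (m, n, k) := f in (0 < m) && (n < 0).

Lemma hyperboloid0E Delta f :
  hyperboloid0 Delta f <-> disc f = Delta /\ indefinite f.
Proof.
rewrite /hyperboloid0 /hyperboloid /= discE.
case: f => [[m n] k] /=; split; [case=> -> ? ?|case=> -> ?]; split=> //; lia.
Qed.

Definition river_step (f : good_point) : good_point :=
  let: (m, n, k) := f in if 0 < m + n + k then B f else A f.

Lemma stepAB_orbit f g : stepAB f g -> orbit f g.
Proof. by case/orP=> /eqP ->; [exact: orbit_A | exact: orbit_B]. Qed.

Lemma river_stepAB f : stepAB f (river_step f).
Proof.
case: f => [[m n] k]; rewrite /stepAB /river_step.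
by case: ifP; rewrite eqxx ?orbT.
Qed.

Lemma river_step_neq f : indefinite f -> river_step f != f.
Proof.
case: f => [[m n] k] /= fH; apply/eqP.
by case: ifP => _ []; lia.
Qed.

(** If [A f] and [B g] coincide, the first coefficient of g equals the second
    one of f, although the former is positive and the latter negative. *)
Lemma river_step_inj f g :
  indefinite f -> indefinite g -> river_step f = river_step g -> f = g.
Proof.
case: f g => [[m n] k] [[m' n'] k'] /= fH gH.
case: ifP => h; case: ifP => h' [] e1 e2 e3;
  first [exfalso; lia | congr (_, _, _); lia].
Qed.

(** * Leaving H^0 is irreversible *)

Definition end_product (f : good_point) : int := let: (m, n, _) := f in m * n.

(** A form with positive coefficients is positive on the nonzero vectors of the
    quadrant x, y >= 0, and the columns of L are such vectors. *)
Lemma substitute_definite a b c d m n k :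
  0 <= a -> 0 <= b -> 0 <= c -> 0 <= d -> a * d - b * c = 1 ->
  0 < m -> 0 < n -> 0 < k -> 0 < end_product (substitute a b c d (m, n, k)).
Proof.
move=> a0 b0 c0 d0 det1 m0 n0 k0.
have pos x y : 0 <= x -> 0 <= y -> 0 < x + y ->
    0 < m * x ^+ 2 + n * y ^+ 2 + k * x * y.
  move=> x0 y0 xy.
  have kxy : 0 <= k * x * y by rewrite !mulr_ge0 // ltW.
  have mx : 0 <= m * x ^+ 2 by rewrite mulr_ge0 ?sqr_ge0 // ltW.
  have ny : 0 <= n * y ^+ 2 by rewrite mulr_ge0 ?sqr_ge0 // ltW.
  have [x1|y1] : 0 < x \/ 0 < y by lia.
    have : 0 < m * x ^+ 2 by rewrite mulr_gt0 // exprn_gt0.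
    lia.
  have : 0 < n * y ^+ 2 by rewrite mulr_gt0 // exprn_gt0.
  lia.
by rewrite /= mulr_gt0 // pos //; nia.
Qed.

Lemma substitute_negdefinite a b c d m n k :
  0 <= a -> 0 <= b -> 0 <= c -> 0 <= d -> a * d - b * c = 1 ->
  m < 0 -> n < 0 -> k < 0 -> 0 < end_product (substitute a b c d (m, n, k)).
Proof.
move=> a0 b0 c0 d0 det1 m0 n0 k0.
have -> : end_product (substitute a b c d (m, n, k)) =
          end_product (substitute a b c d (- m, - n, - k)) by rewrite /=; ring.
by apply: substitute_definite => //; lia.
Qed.

(** * Sign patterns of unimodular matrices *)

(** In this order: L is nonnegative; L^-1 is nonnegative; both columns of L lie
    in one quadrant up to sign, in the wrong order, that quadrant being
    x, y >= 0 for the third pattern and x >= 0 >= y for the fourth. *)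
Definition sign_pattern (a b c d : int) : Prop :=
  [\/ [/\ 0 <= a, 0 <= b, 0 <= c & 0 <= d],
      [/\ 0 <= a, b <= 0, c <= 0 & 0 <= d],
      [/\ a <= 0, 0 <= b, c <= 0 & 0 <= d] |
      [/\ 0 <= a, 0 <= b, c <= 0 & d <= 0]].

(** Since a d = b c + 1, the products a d and b c have weakly the same sign:
    either a agrees with d and b with c, or a is opposed to d and b to c.  This
    leaves eight patterns, exchanged in pairs by L -> - L, which does not change
    the action on forms. *)
Lemma det1_sign_pattern (a b c d : int) : a * d - b * c = 1 ->
  sign_pattern a b c d \/ sign_pattern (- a) (- b) (- c) (- d).
Proof.
move=> det1.
have same (x y : int) : 0 <= x * y ->
    (0 <= x /\ 0 <= y) \/ (x <= 0 /\ y <= 0).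
  by case: (lerP 0 x) => x0; case: (lerP 0 y) => y0 xy; first [nia | lia].
have [ad|ad] := ltrP 0 (a * d).
  have := same b c ltac:(lia); have := same a d ltac:(lia).
  case=> -[? ?] [] [? ?]; [left|left|right|right].
  - by constructor 1; split; lia.
  - by constructor 2; split; lia.
  - by constructor 2; split; lia.
  - by constructor 1; split; lia.
have := same b (- c) ltac:(lia); have := same a (- d) ltac:(lia).
case=> -[? ?] [] [? ?]; [left|right|left|right].
- by constructor 4; split; lia.
- by constructor 3; split; lia.
- by constructor 3; split; lia.
- by constructor 4; split; lia.
Qed.

(** * Two points of H^0 in one orbit lie on one river *)

Section NonSquare.

Variables (Delta : int) (Delta_nsq : ~ exists r : int, Delta = r ^+ 2).

(** A form with f(1, 1) = 0 factors over the rationals, and its discriminant is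
    then a square. *)
Lemma diag_neq0 m n k : disc (m, n, k) = Delta -> m + n + k != 0.
Proof.
move=> fD; apply/eqP => mnk; apply: Delta_nsq; exists (m - n).
have kE : k = - (m + n) by lia.
by rewrite -fD kE /=; ring.
Qed.

Lemma river_step_indefinite f :
  disc f = Delta -> indefinite f -> indefinite (river_step f).
Proof.
case: f => [[m n] k] /diag_neq0 mnk /=.
by case: ifP => h /=; lia.
Qed.

(** Inside H^0 the choice between [A] and [B] is forced, so cycles in H^0 are
    cycles of a function. *)
Lemma stepAB_indefinite f g : disc f = Delta -> indefinite f ->
  stepAB f g -> indefinite g -> g = river_step f.
Proof.
case: f => [[m n] k] /diag_neq0 mnk /= fH /orP[] /eqP -> /=;
  case: ifP => h /= gH //; lia.
Qed.

Lemma river_step_disc f : disc (river_step f) = disc f.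
Proof. exact/disc_orbit/stepAB_orbit/river_stepAB. Qed.

Lemma iter_river i f : disc f = Delta -> indefinite f ->
  [/\ disc (iter i river_step f) = Delta, indefinite (iter i river_step f)
     & orbit f (iter i river_step f)].
Proof.
move=> fD fH; elim: i => [|i [iD iH iO]].
  by split=> //; exact: orbit_refl.
rewrite iterS river_step_disc; split=> //; first exact: river_step_indefinite.
by apply: orbit_trans iO _; apply/stepAB_orbit/river_stepAB.
Qed.

Lemma iter_river_inj i f g :
  disc f = Delta -> indefinite f -> disc g = Delta -> indefinite g ->
  iter i river_step f = iter i river_step g -> f = g.
Proof.
move=> fD fH gD gH; elim: i => //= i IHi E; apply: IHi.
have [_ fiH _] := iter_river i fD fH; have [_ giH _] := iter_river i gD gH.
exact: river_step_inj E.
Qed.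

(** The Euclidean algorithm on the rows of L: in a nonnegative matrix of
    determinant 1 other than the identity one row dominates the other, and
    subtracting the smaller row amounts to having first applied [A] or [B] to f.
    If that step leaves H^0, all coefficients have the same sign and the end
    coefficients keep a common sign from then on. *)
Lemma climb a b c d f :
  0 <= a -> 0 <= b -> 0 <= c -> 0 <= d -> a * d - b * c = 1 ->
  disc f = Delta -> indefinite f ->
  (exists i, substitute a b c d f = iter i river_step f) \/
  0 < end_product (substitute a b c d f).
Proof.
have [N] := ubnP (absz (a + b + c + d)).
elim: N a b c d f => // N IHN a b c d f leN a0 b0 c0 d0 det1.
case: f => [[m n] k] fD fH; have mnk := diag_neq0 fD.
have stepD : disc (river_step (m, n, k)) = Delta by rewrite river_step_disc.
have stepH := river_step_indefinite fD fH.
have [[ac bd]|[[ac bd]|idm]] : (c <= a /\ d <= b) \/ (a <= c /\ b <= d) \/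
    [/\ a = 1, b = 0, c = 0 & d = 1].
- case: (lerP c a) => ca; case: (lerP d b) => db; first by left.
  + have [e|e] := eqVneq a c; first by right; left; split; lia.
    have ca' : c + 1 <= a by lia.
    have bd' : b + 1 <= d by lia.
    by right; right; split; nia.
  + nia.
  + by right; left; split; lia.
- have -> : substitute a b c d (m, n, k) =
            substitute (a - c) (b - d) c d (A (m, n, k)).
    by rewrite /A /substitute; congr (_, _, _); ring.
  have det1' : (a - c) * d - (b - d) * c = 1 by rewrite -det1; ring.
  have lt1 : 0 < c + d by nia.
  case: (ltrP 0 (m + n + k)) => s.
    by right; apply: substitute_definite => //; move: fH => /=; lia.
  have stepE : river_step (m, n, k) = A (m, n, k) by rewrite /= ifN //; lia.
  rewrite stepE in stepD stepH.
  have [[i ->]|pos] :=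
    IHN (a - c) (b - d) c d _ ltac:(lia) ltac:(lia) ltac:(lia) ltac:(lia)
      ltac:(lia) det1' stepD stepH.
    by left; exists i.+1; rewrite iterSr stepE.
  by right.
- have -> : substitute a b c d (m, n, k) =
            substitute a b (c - a) (d - b) (B (m, n, k)).
    by rewrite /B /substitute; congr (_, _, _); ring.
  have det1' : a * (d - b) - b * (c - a) = 1 by rewrite -det1; ring.
  have lt1 : 0 < a + b by nia.
  case: (ltrP (m + n + k) 0) => s.
    by right; apply: substitute_negdefinite => //; move: fH => /=; lia.
  have stepE : river_step (m, n, k) = B (m, n, k) by rewrite /= ifT //; lia.
  rewrite stepE in stepD stepH.
  have [[i ->]|pos] :=
    IHN a b (c - a) (d - b) _ ltac:(lia) ltac:(lia) ltac:(lia) ltac:(lia)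
      ltac:(lia) det1' stepD stepH.
    by left; exists i.+1; rewrite iterSr stepE.
  by right.
- by case: idm => -> -> -> ->; left; exists 0%N; rewrite substitute1.
Qed.

Lemma climb_indefinite a b c d f :
  0 <= a -> 0 <= b -> 0 <= c -> 0 <= d -> a * d - b * c = 1 ->
  disc f = Delta -> indefinite f -> indefinite (substitute a b c d f) ->
  exists i, substitute a b c d f = iter i river_step f.
Proof.
move=> a0 b0 c0 d0 det1 fD fH; have [//|] := climb a0 b0 c0 d0 det1 fD fH.
by case: (substitute _ _ _ _ _) => [[m n] k] /=; nia.
Qed.

(** The property that rules out the two sign patterns in which the columns
    of L come in the wrong order. *)
Lemma climb_not_reversed a b c d f :
  0 <= a -> 0 <= b -> 0 <= c -> 0 <= d -> a * d - b * c = 1 ->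
  disc f = Delta -> indefinite f ->
  let: (m, n, _) := substitute a b c d f in ~ (m < 0 < n).
Proof.
move=> a0 b0 c0 d0 det1 fD fH.
have [[i ->]|] := climb a0 b0 c0 d0 det1 fD fH.
  have [_ + _] := iter_river i fD fH.
  by case: (iter i river_step f) => [[m n] k] /=; lia.
by case: (substitute _ _ _ _ _) => [[m n] k] /=; nia.
Qed.

Lemma river_connected f g : disc f = Delta -> indefinite f -> indefinite g ->
  orbit f g ->
  (exists i, g = iter i river_step f) \/ (exists i, f = iter i river_step g).
Proof.
move=> fD fH gH fg; have gD : disc g = Delta by rewrite (disc_orbit fg).
have {fg} [a [b [c [d [det1 gE sgn]]]]] : exists a b c d,
    [/\ a * d - b * c = 1, g = substitute a b c d f & sign_pattern a b c d].
  have /orbitP[a [b [c [d [det1 gE]]]]] := fg.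
  have [sgn|sgn] := det1_sign_pattern det1; first by exists a, b, c, d.
  exists (- a), (- b), (- c), (- d); split=> //; first by rewrite -det1; ring.
  by rewrite gE; case: (f) => [[m n] k]; congr (_, _, _); ring.
case: sgn => [] [a0 b0 c0 d0].
- by left; rewrite gE; apply: climb_indefinite => //; rewrite -gE.
- right; have fE : f = substitute d (- b) (- c) a g by rewrite gE substituteK.
  by rewrite {1}fE; apply: climb_indefinite; rewrite -?fE //; lia.
- (* If g = (m', n', k'), this matrix takes f to (n', m', - k'). *)
  have := @climb_not_reversed b (- a) d (- c) f b0 ltac:(lia) d0 ltac:(lia)
    ltac:(lia) fD fH.
  by move: gH; rewrite gE; case: (f) => [[m n] k] /=; rewrite !sqrrN; lia.
- (* Change the basis of f by the reflection y -> - y, which sends (m, n, k)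
     to (m, n, - k); the matrix takes this form to (n', m', k'). *)
  have := @climb_not_reversed b a (- d) (- c)
    (let: (m, n, k) := f in (m, n, - k)).
  move: fD fH gH; rewrite gE; case: (f) => [[m n] k] /= fD fH gH.
  move=> /(_ b0 a0 ltac:(lia) ltac:(lia) ltac:(lia)).
  by rewrite !sqrrN => /(_ fD fH); lia.
Qed.

End NonSquare.

(** * Every orbit meets H^0 *)

(** Descent on |k|.  When 0 < m n, k^2 = Delta + 4 m n > 4 min(|m|, |n|)^2, so
    shifting k towards 0 by twice the coefficient of smaller absolute value
    decreases |k|. *)
Lemma orbit_meets_river Delta f : 0 < Delta ->
  (~ exists r : int, Delta = r ^+ 2) -> disc f = Delta ->
  exists2 g, orbit f g & indefinite g.
Proof.
move=> D0 nsq; have [N] := ubnP (absz (coordK f)).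
elim: N f => // N IHN [[m n] k] leN fD; rewrite /= in leN fD.
have m0 : m != 0 by apply/eqP => m0; apply: nsq; exists k; rewrite -fD m0; ring.
have n0 : n != 0 by apply/eqP => n0; apply: nsq; exists k; rewrite -fD n0; ring.
have [mn|mn] := ltrP (m * n) 0.
  have [m1|m1] := ltrP 0 m.
    by exists (m, n, k); [exact: orbit_refl | rewrite /=; nia].
  exists (n, m, - k); last by rewrite /=; nia.
  apply/orbitP; exists 0, (-1), 1, 0; split=> //.
  by rewrite /substitute; congr (_, _, _); ring.
have shift g : orbit (m, n, k) g -> (absz (coordK g) < absz k)%N ->
    exists2 h, orbit (m, n, k) h & indefinite h.
  move=> fg ltk; have [||h gh hH] := IHN g; first by lia.
    by rewrite (disc_orbit fg).
  by exists h => //; exact: orbit_trans gh.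
have [mlen|nltm] := lerP `|m| `|n|.
  have km : `|m| < `|k|.
    by apply: contraT; rewrite -leNgt => ?; nia.
  case: (ltrP 0 (k * m)) => skm.
    apply: (shift (substitute 1 (-1) 0 1 (m, n, k))); last by rewrite /=; nia.
    by apply/orbitP; exists 1, (-1), 0, 1.
  apply: (shift (substitute 1 1 0 1 (m, n, k))); last by rewrite /=; nia.
  by apply/orbitP; exists 1, 1, 0, 1.
have km : `|n| < `|k|.
  by apply: contraT; rewrite -leNgt => ?; nia.
case: (ltrP 0 (k * n)) => skm.
  apply: (shift (substitute 1 0 (-1) 1 (m, n, k))); last by rewrite /=; nia.
  by apply/orbitP; exists 1, 0, (-1), 1.
apply: (shift (substitute 1 0 1 1 (m, n, k))); last by rewrite /=; nia.
by apply/orbitP; exists 1, 0, 1, 1.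
Qed.

(** * Cycles of a function up to rotation *)

Definition rotations (c : seq good_point) : set (seq good_point) :=
  [set c' | exists i, c' = rot i c].

Lemma rotations_rot i c : rotations (rot i c) = rotations c.
Proof.
apply/seteqP; split=> _ [j ->].
  by rewrite rot_rot_add; eexists.
exists (rot_add (rot i c) (size c - i) j).
by rewrite -rot_rot_add -{1}(rotK i c) /rotr size_rot.
Qed.

Lemma cycle_points_rotations c f : cycle_points (rotations c) f <-> f \in c.
Proof.
split=> [[_ [i ->]]|fc]; first by rewrite mem_rot.
by exists c => //; exists 0%N; rewrite rot0.
Qed.

Lemma fcycle_traject (T : eqType) (h : T -> T) x s : fcycle h (x :: s) ->
  x :: s = traject h x (size s).+1 /\ iter (size s).+1 h x = x.
Proof.
move=> /= hs; have := fpathE hs; rewrite size_rcons => E.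
have /rcons_inj[sE xE] : rcons s x =
    rcons (traject h (h x) (size s)) (iter (size s).+1 h x).
  by rewrite E trajectSr -iterSr.
by split; first by rewrite {1}sE.
Qed.

(** Both cycles list the successive images of x, and each stops at the first
    return to x since it has no repetition. *)
Lemma fcycle_inj (T : eqType) (h : T -> T) x s s' :
  fcycle h (x :: s) -> uniq (x :: s) -> fcycle h (x :: s') -> uniq (x :: s') ->
  s = s'.
Proof.
move=> /fcycle_traject[E ret] U /fcycle_traject[E' ret'] U'.
have ss' : size s = size s'.
  wlog lt : s s' E ret U E' ret' U' / (size s < size s')%N => [main|].
    have [lt|lt|//] := ltngtP (size s) (size s'); first exact: main lt.
    by apply/esym; apply: main lt.
  move: U' => /=; rewrite -{1}ret; case/andP=> /negP[].
  case: E' => ->; apply/trajectP; exists (size s); rewrite -?iterSr //.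
by case: E E' => -> [->]; rewrite ss'.
Qed.

Lemma fcycle_rotations (h : good_point -> good_point) c c' x :
  fcycle h c -> uniq c -> fcycle h c' -> uniq c' -> x \in c -> x \in c' ->
  rotations c = rotations c'.
Proof.
move=> hc Uc hc' Uc' /rot_to[i s sE] /rot_to[j s' s'E].
rewrite -(rotations_rot i c) -(rotations_rot j c') sE s'E.
by rewrite (@fcycle_inj _ h x s s') // -?sE -?s'E ?rot_cycle ?rot_uniq.
Qed.

(** Pigeonhole: a trajectory confined to a finite list repeats, and by
    injectivity the first value to come back is the initial one. *)
Lemma finite_traject_return (T : eqType) (h : T -> T) x (s : seq T) :
  (forall i, iter i h x \in s) ->
  (forall i j, iter i h x = iter i h (iter j h x) -> x = iter j h x) ->
  exists p, [/\ iter p.+1 h x = x & uniq (traject h x p.+1)].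
Proof.
move=> ins inj.
have returns i j : (i < j)%N -> iter j h x = iter i h x ->
    (0 < j - i)%N && (iter (j - i) h x == x).
  move=> ij E; rewrite subn_gt0 ij /=; apply/eqP/esym/(inj i).
  by rewrite -iterD subnKC ?E // ltnW.
have ex : exists p, (0 < p)%N && (iter p h x == x).
  have /trajectP[i ilt E] : looping h x (size s).
    rewrite -[looping _ _ _]negbK -looping_uniq; apply/negP => U.
    have : (size (traject h x (size s).+1) <= size s)%N.
      by apply: uniq_leq_size => // _ /trajectP[i _ ->].
    by rewrite size_traject ltnn.
  by exists (size s - i)%N; apply: returns.
case: (ex_minnP ex) => [[//|p]] /andP[_ /eqP ret] pmin; exists p; split=> //.
rewrite looping_uniq; apply/negP => /trajectP[i ilt E].
by have := pmin _ (returns _ _ ilt E); lia.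
Qed.

(** * The correspondence *)

Definition box (N : nat) : seq good_point :=
  let r := [seq i%:Z - N%:Z | i <- iota 0 (N + N).+1] in
  [seq (u, k) | u <- [seq (m, n) | m <- r, n <- r], k <- r].

(** Finiteness of H^0: the discriminant is k^2 + 4 m |n| with m and |n|
    positive, so it bounds every coefficient. *)
Lemma indefinite_box f : indefinite f -> f \in box (absz (disc f)).
Proof.
have mem_r (N : nat) (x : int) : `|x| <= N%:Z ->
    x \in [seq i%:Z - N%:Z | i <- iota 0 (N + N).+1].
  move=> xN; apply/mapP; exists (absz (x + N%:Z)); last by lia.
  by rewrite mem_iota; lia.
case: f => [[m n] k] fH.
have [mB nB kB] : [/\ `|m| <= disc (m, n, k), `|n| <= disc (m, n, k)
    & `|k| <= disc (m, n, k)].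
  by move: fH => /= /andP[m0 n0]; split; nia.
by do 2?apply: allpairs_f; apply: mem_r; lia.
Qed.

Section Rivers.

Variables (Delta : int) (Delta_nsq : ~ exists r : int, Delta = r ^+ 2).

Lemma river_cycle f : disc f = Delta -> indefinite f ->
  exists c, [/\ cycle_seq c, f \in c &
    {in c, forall g, exists i, g = iter i river_step f}].
Proof.
move=> fD fH.
have [i|i j E|p [ret U]] :=
  @finite_traject_return _ river_step f (box (absz Delta)).
- have [<- iH _] := iter_river Delta_nsq i fD fH; exact: indefinite_box.
- have [jD jH _] := iter_river Delta_nsq j fD fH.
  exact: (iter_river_inj Delta_nsq fD fH jD jH E).
have p0 : (0 < p)%N.
  by case: p ret {U} => // /eqP; rewrite (negPf (river_step_neq fH)).
exists (traject river_step f p.+1); split.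
- split=> //; first by rewrite size_traject.
  rewrite [traject _ _ _]/= /path.cycle -{3}ret iterSr -trajectSr.
  apply: sub_path (fpath_traject _ _ _) => g _ /= /eqP <-.
  exact: river_stepAB.
- by rewrite inE eqxx.
- by move=> g /trajectP[i _ ->]; exists i.
Qed.

Lemma river_fcycle c : cycle_seq c ->
  {in c, forall f, hyperboloid0 Delta f} -> fcycle river_step c.
Proof.
move=> [_ cyc _] cH.
pose P := [pred f | (disc f == Delta) && indefinite f].
apply: (@sub_in_cycle _ P _ _ _ _ _ cyc).
  move=> f g /andP[/eqP fD fH] /andP[_ gH] fg.
  by rewrite /= (stepAB_indefinite Delta_nsq fD fH fg gH).
by apply/allP => f /cH /hyperboloid0E[/= -> ->]; rewrite eqxx.
Qed.

Lemma mem_iter_fcycle c f i :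
  fcycle river_step c -> f \in c -> iter i river_step f \in c.
Proof. by move=> cyc fc; elim: i => //= i; exact: mem_fcycle. Qed.

Lemma cycles_in_rotations c : cycle_seq c ->
  {in c, forall f, hyperboloid0 Delta f} ->
  cycles_in (hyperboloid0 Delta) (rotations c).
Proof.
by move=> cyc cH; split=> [|f /cycle_points_rotations /cH //]; exists c.
Qed.

Lemma cycles_inP C : cycles_in (hyperboloid0 Delta) C ->
  exists c, [/\ C = rotations c, cycle_seq c &
    {in c, forall f, hyperboloid0 Delta f}].
Proof.
move=> [[c cyc ->] CH]; exists c; split=> // f fc.
by apply: CH; apply/cycle_points_rotations.
Qed.

Lemma cycle_seq_mem c : cycle_seq c -> exists f, f \in c.
Proof. by case: c => [[]//|f c _]; exists f; rewrite mem_head. Qed.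

Lemma orbits_eq O f : orbits Delta O -> O f -> O = orbit f.
Proof. by move=> [g _ ->]; exact: orbit_eq. Qed.

Lemma orbits_disc O f : orbits Delta O -> O f -> disc f = Delta.
Proof. by move=> [g gD ->] /disc_orbit ->; rewrite discE. Qed.

Lemma orbit_orbits f : disc f = Delta -> orbits Delta (orbit f).
Proof. by move=> fD; exists f => //; rewrite /hyperboloid /= -discE. Qed.

(** Uniqueness: a point of another cycle in O is joined to g by [river_step] in
    one direction or the other, and each cycle is closed under [river_step], so
    the two cycles share a point. *)
Lemma orbit_unique_cycle O : 0 < Delta -> orbits Delta O ->
  exists! C, cycles_in (hyperboloid0 Delta) C /\ cycle_points C `<=` O.
Proof.
move=> D0 OO; have [f0 f0D OE] := OO.
have [g Og gH] : exists2 g, O g & indefinite g.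
  rewrite OE; apply: (orbit_meets_river D0 Delta_nsq).
  by rewrite discE.
have gD := orbits_disc OO Og; have {f0 f0D}OE := orbits_eq OO Og.
have [c [cyc gc cP]] := river_cycle gD gH.
have cH : {in c, forall f, hyperboloid0 Delta f}.
  move=> _ /cP[i ->]; apply/hyperboloid0E.
  by have [] := iter_river Delta_nsq i gD gH.
exists (rotations c); split.
  split; first exact: cycles_in_rotations.
  move=> _ /cycle_points_rotations /cP[i ->]; rewrite OE.
  by have [] := iter_river Delta_nsq i gD gH.
move=> _ [/cycles_inP[c' [-> cyc' cH']] c'O].
have [x xc'] := cycle_seq_mem cyc'.
have /hyperboloid0E[xD xH] := cH' x xc'.
have gx : orbit g x by rewrite -OE; apply/c'O/cycle_points_rotations.
have fc := river_fcycle cyc cH; have fc' := river_fcycle cyc' cH'.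
have [_ _ U] := cyc; have [_ _ U'] := cyc'.
have [[i E]|[i E]] := river_connected Delta_nsq gD gH xH gx.
  have xc : x \in c by rewrite E; exact: mem_iter_fcycle.
  exact: (fcycle_rotations fc U fc' U' xc xc').
have gc' : g \in c' by rewrite E; exact: mem_iter_fcycle.
exact: (fcycle_rotations fc U fc' U' gc gc').
Qed.

Lemma cycle_unique_orbit C : cycles_in (hyperboloid0 Delta) C ->
  exists! O, orbits Delta O /\ cycle_points C `<=` O.
Proof.
move=> /cycles_inP[c [-> cyc cH]].
have [x xc] := cycle_seq_mem cyc; have /hyperboloid0E[xD xH] := cH x xc.
have fc := river_fcycle cyc cH.
exists (orbit x); split; first split; first exact: orbit_orbits.
  move=> y /cycle_points_rotations yc.
  have [i s sE] := rot_to xc.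
  have : fcycle river_step (x :: s) by rewrite -sE rot_cycle.
  move=> /fcycle_traject[E _].
  have /trajectP[j _ ->] : y \in traject river_step x (size s).+1.
    by rewrite -E -sE mem_rot.
  by have [] := iter_river Delta_nsq j xD xH.
move=> O [OO cO]; apply/esym/orbits_eq => //.
exact/cO/cycle_points_rotations.
Qed.

End Rivers.

Theorem theorem4p10 (Delta : int) (Delta_gt0 : 0 < Delta)
    (Delta_nsq : ~ exists r : int, Delta = r ^+ 2) :
  exists Phi : set good_point -> set (seq good_point),
    [/\ set_bij (orbits Delta) (cycles_in (hyperboloid0 Delta)) Phi,
        forall O : set good_point, orbits Delta O ->
          cycle_points (Phi O) `<=` O,
        forall O : set good_point, orbits Delta O ->
          exists! C : set (seq good_point),
            cycles_in (hyperboloid0 Delta) C /\ cycle_points C `<=` O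
      & forall C : set (seq good_point), cycles_in (hyperboloid0 Delta) C ->
          exists! O : set good_point,
            orbits Delta O /\ cycle_points C `<=` O].
Proof.
have uniqC O := orbit_unique_cycle Delta_nsq (O := O) Delta_gt0.
have uniqO C := cycle_unique_orbit Delta_nsq (C := C).
(* Phi O is the one cycle inside O, obtained without choice as a union. *)
pose Phi O : set (seq good_point) :=
  [set c | exists C, [/\ cycles_in (hyperboloid0 Delta) C,
                         cycle_points C `<=` O & C c]].
have PhiE O C : orbits Delta O -> cycles_in (hyperboloid0 Delta) C ->
    cycle_points C `<=` O -> Phi O = C.
  move=> OO CH CO; have [C0 [_ C0U]] := uniqC O OO.
  apply/seteqP; split=> [c [C' [C'H C'O]]|c Cc]; last by exists C.
  by rewrite -(C0U C) // -(C0U C').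
have PhiP O : orbits Delta O ->
    cycles_in (hyperboloid0 Delta) (Phi O) /\ cycle_points (Phi O) `<=` O.
  by move=> OO; have [C [[CH CO] _]] := uniqC O OO; rewrite (PhiE O C).
exists Phi; split=> //; last by move=> O /PhiP[].
split=> [O /PhiP[] //|O O' /set_mem OO /set_mem OO' E|C CH].
  have [PH PO] := PhiP O OO; have [_ PO'] := PhiP O' OO'.
  have [O0 [_ O0U]] := uniqO _ PH.
  by rewrite -(O0U O) // -(O0U O') // E.
have [O [[OO CO] _]] := uniqO C CH.
by exists O => //; exact: PhiE.
Qed.
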